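(* Let $R$ be a domain containing $\mathbb{Q}$. The conjugacy classes of $\mathrm{BAs}_2(R)$ in $\mathrm{BA}_2(R)$ are parametrized by pairs $(\bar f_1,f_2)$ (the pair corresponding to the class of $(x_1+f_1,x_2+f_2)$ with $f_1$ a lift of $\bar f_1$), where either (1) $f_2=0$ and $f_1=a_nx_2^n+a_{n-1}x_2^{n-1}+\cdots+a_0\in R[x_2]$, where $a_{n-1}$ is picked as a unique representative in $R/a_nR$, and then additionally $f_1$ is a unique element in its orbit under the action $\lambda\mapsto\lambda^{-1}f_1(\lambda x_2)$ of $R^*$; or (2) $f_2\in R\setminus\{0\}$ and $\bar f_1=\bar a_nx_2^n+\bar a_{n-1}x_2^{n-1}+\cdots+\bar a_0\in(R/(f_2))[x_2]$, where $\bar a_{n-1}$ is a uniquely picked representative from $(R/(f_2))/(\bar a_n)$, and then additionally $f_1$ is a unique element in its orbit under the action $\lambda\mapsto\lambda^{-1}f_1(\lambda x_2)$ of $R^*$. In particular, if $R=k$ is a field, then the classes are those of (1) $(x_1+f(x_2),x_2)$ with $f(x_2)=f_nx_2^n+f_{n-2}x_2^{n-2}+\cdots+f_0\in k[x_2]$, $f_n\neq0$ (i.e. the next-to-highest term has coefficient zero), where additionally $f$ is a unique element in its orbit under the action $\lambda\mapsto\lambda^{-1}f(\lambda x_2)$ of $k^*$; (2) $(x_1,x_2+1)$; (3) $(x_1,x_2)$.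
   Context: $\mathrm{BA}_2(R)$ is the group (under composition) of triangular polynomial automorphisms $(a_1x_1+f_1,a_2x_2+f_2)$ with $a_1,a_2\in R^*$, $f_1\in R[x_2]$, $f_2\in R$; $\mathrm{BAs}_2(R)$ is its subgroup of strictly triangular maps, those with $a_1=a_2=1$. The conjugacy classes of $\mathrm{BAs}_2(R)$ in $\mathrm{BA}_2(R)$ are the classes of elements of $\mathrm{BAs}_2(R)$ under the relation $G=HFH^{-1}$ for some $H\in\mathrm{BA}_2(R)$. ''Picked as a unique representative'' (resp. ''a unique element in its orbit'') means that a system of representatives for the indicated quotient (resp. for the orbits) is fixed once and for all, and the element is required to lie in that system. The coefficient of index $n$ is the leading coefficient.
   Formalization: Distinct pairs can give the same class (over Q, f_2=0: x_2 and 2x_2), so ''parametrized'' is proved as well-defined and onto, with exact conditions for two pairs (over a field, two f in list (1)) to give the same class in place of uniqueness. *)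

(* Defs.v *)
From mathcomp Require Export all_boot all_order all_algebra.
From mathcomp Require Export boolp classical_sets.
From mathcomp Require Export mpoly.

Set Implicit Arguments.
Unset Strict Implicit.
Unset Printing Implicit Defensive.

Import GRing.Theory.
Local Open Scope classical_set_scope.
Local Open Scope ring_scope.

(* x_1 and x_2 are the multivariate indeterminates of index ord0 and ord_max;
   R[x_2] is {poly R}, embedded in R[x_1, x_2] by [in_x2]. *)

Section PolynomialMaps.
Variable R : idomainType.

(* (F_1, F_2), seen as a polynomial self-map of the affine plane *)
Definition polymap := 2.-tuple {mpoly R[2]}.

Definition pm_id : polymap := [tuple 'X_ord0; 'X_ord_max].

(* F o G, i.e. G is substituted in the components of F *)
Definition pm_comp (F G : polymap) : polymap :=
  map_tuple (fun p => p \mPo G) F.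

Definition in_x2 (f : {poly R}) : {mpoly R[2]} := (map_poly (@mpolyC 2 R) f).['X_ord_max].

Definition triangular (a1 : R) (f1 : {poly R}) (a2 f2 : R) : polymap :=
  [tuple a1 *: 'X_ord0 + in_x2 f1; a2 *: 'X_ord_max + f2%:MP].

Definition strict (f1 : {poly R}) (f2 : R) : polymap :=
  [tuple 'X_ord0 + in_x2 f1; 'X_ord_max + f2%:MP].

Definition BA2 : set polymap :=
  [set H | exists a1 a2 f1 f2,
    [/\ a1 \is a GRing.unit, a2 \is a GRing.unit & H = triangular a1 f1 a2 f2]].

Definition BAs2 : set polymap := [set F | exists f1 f2, F = strict f1 f2].

(* G = H F H^{-1} for some H in BA_2(R); H' is H^{-1} *)
Definition conjBA (F G : polymap) : Prop :=
  exists H H', [/\ BA2 H, BA2 H', pm_comp H H' = pm_id, pm_comp H' H = pm_id &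
                   G = pm_comp H (pm_comp F H')].

Definition conj_class (F : polymap) : set polymap :=
  [set G | BAs2 G /\ conjBA F G].

Definition conj_classes : set (set polymap) := [set conj_class F | F in BAs2].

End PolynomialMaps.

(* T is a system of representatives of D for the relation E *)
Definition representatives X (D : set X) (E : X -> X -> Prop) (T : set X) :=
  T `<=` D /\ forall x, D x -> exists! t, T t /\ E x t.

Section NormalForms.
Variable R : idomainType.
Implicit Types (f g : {poly R}) (a b c d : R) (I : set R).

Definition scale_act (l : R) f : {poly R} := l^-1 *: (f \Po (l *: 'X)).

Definition scale_orbit f g :=
  exists2 l, l \is a GRing.unit & g = scale_act l f.

(* Case f2 = 0.  S a is a system of representatives of R/aR. *)

Definition eq_mod a b c := exists r, c = b + r * a.

Definition coef_choice (S : R -> set R) :=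
  forall a, representatives setT (eq_mod a) (S a).

Definition normalized (S : R -> set R) : set {poly R} :=
  [set f : {poly R} | forall n, size f = n.+2 -> S f`_n.+1 f`_n].

(* Case f2 <> 0.  The ring R/(f2) may be trivial, so that it has no {poly _};
   elements of R/I are represented as cosets a + I, and elements of (R/I)[x],
   which is R[x]/I[x], as cosets f + I[x].  Everything depends on f2 only
   through the set (f2), hence the systems of representatives below are
   attached to R/(f2) and not to the chosen generator f2. *)

Definition ideal d : set R := [set r | exists q, r = q * d].

Definition res I a : set R := [set b | I (b - a)].

Definition res_poly I f : set {poly R} := [set g | forall i, I (g`_i - f`_i)].

(* [A] and [B], in R/I, have the same image in (R/I)/(abar) *)
Definition eq_mod_res (abar A B : set R) :=
  exists a b r, [/\ abar a, A b & B (b + r * a)].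

Definition coef_choice_res (S : set R -> set R -> set (set R)) :=
  forall d a, d != 0 ->
    representatives (range (res (ideal d))) (eq_mod_res (res (ideal d) a))
                    (S (ideal d) (res (ideal d) a)).

(* The degree of fbar is n.+1 when the coefficients of f of index > n.+1 are in
   I, and the one of index n.+1 is not. *)
Definition normalized_res (S : set R -> set R -> set (set R)) I :
    set (set {poly R}) :=
  [set fbar | range (res_poly I) fbar /\
    forall f n, fbar f -> ~ I f`_n.+1 -> (forall i, (n.+1 < i)%N -> I f`_i) ->
      S I (res I f`_n.+1) (res I f`_n)].

Definition scale_orbit_res (fbar gbar : set {poly R}) :=
  exists2 l, l \is a GRing.unit & gbar = [set scale_act l f | f in fbar].

Definition orbit_choice_res (S : set R -> set R -> set (set R))
    (T : set R -> set (set {poly R})) :=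
  forall d, d != 0 ->
    representatives (normalized_res S (ideal d)) scale_orbit_res (T (ideal d)).

(* Pairs (fbar1, f2); as R/(0) = R, the polynomial f1 of the case f2 = 0 is
   the coset [set f1]. *)
Definition param := (set {poly R} * R)%type.

Definition params1 (T : set {poly R}) : set param :=
  [set p | exists2 f, T f & p = ([set f], 0)].

Definition params2 (T : set R -> set (set {poly R})) : set param :=
  [set p | p.2 != 0 /\ T (ideal p.2) p.1].

(* The union of the classes of (x_1 + f, x_2 + f2), for all lifts f of fbar1;
   that they are all the same class is part of the theorem. *)
Definition param_class (p : param) : set (polymap R) :=
  [set G | exists2 f, p.1 f & conj_class (strict f p.2) G].

(* The residual freedom: conjugation by (a1 x_1 + h(x_2), a2 x_2 + c) sends
   (x_1 + f, x_2 + f2) to (x_1 + g, x_2 + a2 f2), where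
   g(a2 x + c) = a1 f(x) + h(x + f2) - h(x). *)
Definition same_param_class (p q : param) :=
  exists a1 a2 c f g,
    [/\ a1 \is a GRing.unit /\ a2 \is a GRing.unit, p.1 f /\ q.1 g,
        q.2 = a2 * p.2 &
        res_poly (ideal p.2) (a1 *: f) (g \Po (a2 *: 'X + c%:P))].

End NormalForms.

(* Polynomials f_n x^n + f_{n-2} x^{n-2} + ... + f_0 with f_n <> 0 *)
Definition depressed (k : fieldType) : set {poly k} :=
  [set f : {poly k} | f != 0 /\ forall n, size f = n.+2 -> f`_n = 0].

(* Main.v *)
(* Conjugating (x_1 + f, x_2 + d) by (a x_1 + h(x_2), b x_2 + c) gives
   (x_1 + g, x_2 + b d) with g(b x + c) = a f(x) + h(x + d) - h(x).  As R contains
   the rationals, the differences h(x + d) - h(x) are exactly the elements of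
   d R[x]: their leading terms are those of d h', and h' is arbitrary.  Hence only
   the class of f modulo d matters, and the only moves left are scalings and
   translations of x_2.  The translation by c adds (n + 1) a_{n+1} c to the
   coefficient of index n of a polynomial of degree n + 1, which reaches every
   element of its class modulo a_{n+1}; over a field it can be made zero, after
   which no nontrivial translation is left. *)

Require Import Defs.
From mathcomp Require Import ring.

Set Implicit Arguments.
Unset Strict Implicit.
Unset Printing Implicit Defensive.

Import GRing.Theory.
Local Open Scope classical_set_scope.
Local Open Scope ring_scope.

(** * Triangular maps: composition, inverses and conjugates *)

Section Maps.
Variable R : idomainType.
Implicit Types (f g h : {poly R}) (a b c d e : R).

(** Substitution of [u] for x_1 and ['X] for x_2. The values u = 0 and u = 1 are enough to read off
    all the data of a triangular map. *)
Let ev (u : {poly R}) : {rmorphism {mpoly R[2]} -> {poly R}} :=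
  mmap (@polyC R) (fun i => if i == ord0 then u else 'X).

Lemma ev_triangular u a f b d : map (ev u) (triangular a f b d) =
  [:: a *: u + f; b *: 'X + d%:P].
Proof.
have evx (i : 'I_2) : ev u 'X_i = if i == ord0 then u else 'X.
  by rewrite [LHS]mmapX mmap1U.
have evC c : ev u c%:MP = c%:P by rewrite [LHS]mmapC.
have evZ c p : ev u (c *: p) = c *: ev u p by rewrite [LHS]mmapZ mul_polyC.
rewrite /= !rmorphD !evZ !evx evC /=.
congr [:: _ + _; _].
rewrite /in_x2 -horner_map evx /=.
by rewrite -map_poly_comp (eq_map_poly evC) -[RHS]comp_polyXr.
Qed.

Lemma triangular_inj a f b d a' f' b' d' :
  triangular a f b d = triangular a' f' b' d' ->
  [/\ a = a', f = f', b = b' & d = d'].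
Proof.
move=> /(congr1 (@tval _ _)) E.
have E' u i := congr1 (fun s => nth 0 (map (ev u) s) i) E.
move: (E' 0 0) (E' 1 0) (E' 0 1); rewrite !ev_triangular /= !scaler0 !add0r.
move=> ff E1 E2; move: E1; rewrite ff => /addIr E1.
split=> //.
- by have /(congr1 (fun p : {poly R} => p`_0)) := E1; rewrite !coefZ coef1 !mulr1.
- by have /(congr1 (fun p : {poly R} => p`_1)) := E2; rewrite !coefE !mulr1 !addr0.
- by have /(congr1 (fun p : {poly R} => p`_0)) := E2; rewrite !coefE !mulr0 !add0r.
Qed.

Lemma strictE f d : strict f d = triangular 1 f 1 d.
Proof. by rewrite /triangular !scale1r. Qed.

Lemma strict_inj f d f' d' : strict f d = strict f' d' -> f = f' /\ d = d'.
Proof. by rewrite !strictE => /triangular_inj[]. Qed.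

Lemma pm_idE : pm_id R = triangular 1 0 1 0.
Proof.
by rewrite /triangular /in_x2 !scale1r map_polyC hornerC /= mpolyC0 !addr0.
Qed.

Lemma in_x2_comp f b d : in_x2 (f \Po (b *: 'X + d%:P)) =
  (map_poly (@mpolyC 2 R) f).[b *: 'X_ord_max + d%:MP].
Proof.
rewrite /in_x2 (map_comp_poly (@mpolyC 2 R)) horner_comp; congr (_.[_]).
rewrite rmorphD /= -mul_polyC rmorphM /= map_polyX !map_polyC /=.
by rewrite hornerD hornerM !hornerC hornerX mul_mpolyC.
Qed.

Lemma comp_triangular a f b d a' f' b' d' :
  pm_comp (triangular a f b d) (triangular a' f' b' d') =
  triangular (a * a') (a *: f' + (f \Po (b' *: 'X + d'%:P))) (b * b') (b * d' + d).
Proof.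
have in_x2D (p q : {poly R}) : in_x2 (p + q) = in_x2 p + in_x2 q.
  by rewrite /in_x2 rmorphD hornerD.
have in_x2Z c (p : {poly R}) : in_x2 (c *: p) = c *: in_x2 p.
  by rewrite /in_x2 -mul_polyC rmorphM /= map_polyC /= hornerM hornerC mul_mpolyC.
apply: val_inj => /=; congr [:: _; _].
- rewrite comp_mpolyD comp_mpolyZ (comp_mpolyXU ord0) /= in_x2D in_x2Z in_x2_comp.
  rewrite scalerDr scalerA -addrA; congr (_ + (_ + _)).
  rewrite /in_x2 -horner_map /= (comp_mpolyXU ord_max) /=; congr (_.[_]).
  by rewrite -map_poly_comp; apply: eq_map_poly => c /=; rewrite comp_mpolyC.
- rewrite comp_mpolyD comp_mpolyZ (comp_mpolyXU ord_max) comp_mpolyC /=.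
  by rewrite scalerDr scalerA mpolyCD mpolyCM -addrA mul_mpolyC.
Qed.

Lemma affine_comp a b c e : (a *: 'X + c%:P) \Po (b *: 'X + e%:P) =
  (a * b) *: 'X + (a * e + c)%:P :> {poly R}.
Proof.
rewrite comp_polyD comp_polyZ comp_polyX comp_polyC scalerDr scalerA.
by rewrite polyCD polyCM -!addrA mul_polyC.
Qed.

Lemma affine_id : 1 *: 'X + 0%:P = 'X :> {poly R}.
Proof. by rewrite scale1r addr0. Qed.

Lemma affine_compVl b c : b \is a GRing.unit ->
  (b^-1 *: 'X + (- (b^-1 * c))%:P) \Po (b *: 'X + c%:P) = 'X :> {poly R}.
Proof. by move=> ub; rewrite affine_comp mulVr // subrr affine_id. Qed.

Lemma affine_compVr b c : b \is a GRing.unit ->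
  (b *: 'X + c%:P) \Po (b^-1 *: 'X + (- (b^-1 * c))%:P) = 'X :> {poly R}.
Proof. by move=> ub; rewrite affine_comp mulrN mulrA mulrV // mul1r addNr affine_id. Qed.

Lemma conjBA_strict f d G : conjBA (strict f d) G <->
  exists a b c g h, [/\ a \is a GRing.unit, b \is a GRing.unit,
    G = strict g (b * d) &
    g \Po (b *: 'X + c%:P) = a *: f + (h \Po ('X + d%:P)) - h].
Proof.
split.
- case=> _ [_] [[a [b [h [c [ua ub ->]]]]] [a' [b' [k [c' [_ _ ->]]]]]].
  rewrite pm_idE strictE !comp_triangular !mul1r !scale1r.
  move=> /triangular_inj[aa' _ bb' cc'] /triangular_inj[_ E b'b c'c] ->.
  exists a, b, c; rewrite aa' bb' mulrDr addrAC cc' add0r -strictE.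
  do 2!eexists; split=> //.
  rewrite comp_polyD comp_polyZ comp_polyD -!comp_polyA !affine_comp.
  rewrite b'b c'c addrA c'c add0r affine_id comp_polyXr scale1r.
  (* This is the first component of H' H = id. *)
  have -> : k \Po (b *: 'X + c%:P) = - (a' *: h).
    by apply/eqP; rewrite -addr_eq0 addrC E.
  rewrite scalerDr scalerN scalerA aa' !scale1r.
  by rewrite -[LHS]addrA addrC.
- case=> a [b [c [g [h [ua ub -> E]]]]].
  (* Solving y_1 = a x_1 + h(x_2), y_2 = b x_2 + c for x_1 gives the term a^-1 y_1 plus [k]
     evaluated at y_2. *)
  pose k := - (a^-1 *: (h \Po (b^-1 *: 'X + (- (b^-1 * c))%:P))).
  exists (triangular a h b c), (triangular a^-1 k b^-1 (- (b^-1 * c))); split.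
  + by exists a, b, h, c.
  + by exists a^-1, b^-1, k, (- (b^-1 * c)); rewrite !unitrV.
  + rewrite comp_triangular pm_idE !mulrV // scalerN scalerA mulrV // scale1r.
    by rewrite addNr mulrN mulVKr // addNr.
  + rewrite comp_triangular pm_idE !mulVr // /k -scaleN1r !comp_polyZ.
    by rewrite -comp_polyA affine_compVl // comp_polyXr scaleN1r !subrr.
  rewrite !strictE !comp_triangular !mul1r !scale1r !mulrV //.
  have -> : b * (- (b^-1 * c) + d) + c = b * d.
    by rewrite mulrDr mulrN mulVKr // addrAC addNr add0r.
  congr (triangular _ _ _ _).
  (* [g] is recovered from g(b x + c) by composing with the inverse affine map. *)
  rewrite -[LHS]comp_polyXr -[X in _ \Po X = _](affine_compVr c ub) comp_polyA E.
  rewrite comp_polyB comp_polyD comp_polyZ -[(_ \Po ('X + _)) \Po _]comp_polyA.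
  rewrite -[X in h \Po ((X + _) \Po _)]scale1r affine_comp !mul1r /k.
  rewrite scalerDr scalerN scalerA mulrV //.
  by rewrite scale1r -[RHS]addrA [RHS]addrC.
Qed.

End Maps.

(** * The difference equation, and conjugacy as an affine congruence modulo [d] *)

Section Shift.
Variable R : idomainType.
Implicit Types (f g h q : {poly R}) (a b c d e : R).

Lemma res_polyP d f g : res_poly (ideal d) f g <-> exists q, g = f + d *: q.
Proof.
split=> [fg|[q ->] i]; last by exists q`_i; rewrite coefD coefZ addrC addKr mulrC.
(* The quotients are chosen index by index, so they must be cut off to form a polynomial; beyond the
   size of [g - f] the difference vanishes anyway. *)
have [q qE] := choice fg; exists (\poly_(i < size (g - f)) q i).
rewrite addrC; apply/eqP; rewrite -subr_eq; apply/eqP/polyP=> i.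
rewrite coefZ coef_poly; case: ltnP => [_|/(nth_default 0) ->]; last by rewrite mulr0.
by rewrite coefB qE mulrC.
Qed.

(** For h x + c the difference is (h(x + d) - h(x)) x + d h(x + d), so divisibility passes through
    the induction. *)
Lemma shift_sub_dvd h d : exists q, (h \Po ('X + d%:P)) - h = d *: q.
Proof.
elim/poly_ind: h => [|h c [q hq]]; first by exists 0; rewrite comp_poly0 subrr scaler0.
exists (q * 'X + (h \Po ('X + d%:P))); rewrite comp_poly_MXaddC -!mul_polyC.
have -> : h \Po ('X + d%:P) = h + d%:P * q by rewrite mul_polyC -hq [RHS]addrC subrK.
by ring.
Qed.

Lemma size_comp_shift f c : size (f \Po ('X + c%:P)) = size f.
Proof. by rewrite size_comp_poly2 // size_XaddC. Qed.

Lemma comp_shift_coefS n c f : (size f <= n.+1)%N ->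
  (f \Po ('X + c%:P))`_n = f`_n.
Proof.
elim: n f => [|n IHn] f; elim/poly_ind: f => [|f b _]; rewrite ?comp_poly0 //.
all: rewrite comp_poly_MXaddC size_MXaddC !coefD !coefMX !coefC mulrDr.
all: rewrite coefD coefMX coefMC /=.
  case: ifP => [/andP[/eqP-> _] _|_]; first by rewrite comp_poly0 coef0 mul0r addr0.
  by rewrite ltnS leqn0 size_poly_eq0 => /eqP->; rewrite comp_poly0 coef0 mul0r addr0.
case: ifP => [/andP[/eqP-> _] _|_]; first by rewrite comp_poly0 !coef0 mul0r addr0.
rewrite ltnS => sf; rewrite !addr0 IHn //.
rewrite [X in X * c]nth_default ?mul0r ?addr0 //.
by rewrite size_comp_shift.
Qed.

(** Only the terms of index n and n + 1 contribute. The size is merely bounded, so that truncations,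
    whose top coefficient is only known modulo an ideal, are covered. *)
Lemma comp_shift_coef n c f : (size f <= n.+2)%N ->
  (f \Po ('X + c%:P))`_n = f`_n + n.+1%:R * f`_n.+1 * c.
Proof.
elim: n f => [|n IHn] f; elim/poly_ind: f => [|f b _];
  rewrite ?comp_poly0 ?coef0 ?mulr0 ?mul0r ?addr0 //.
all: rewrite comp_poly_MXaddC size_MXaddC !coefD !coefMX !coefC mulrDr.
all: rewrite coefD coefMX coefMC /=.
all: rewrite ?addr0 ?add0r.
all: case: ifP => [/andP[/eqP-> _] _|_];
  first by rewrite comp_poly0 ?coef0 ?mulr0 ?mul0r ?addr0 ?add0r.
all: rewrite ltnS => sf.
  by rewrite comp_shift_coefS // addrC mul1r.
by rewrite IHn // comp_shift_coefS // [n.+2%:R]mulrS; ring.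
Qed.

Lemma comp_scale_coef a f i : (f \Po (a *: 'X))`_i = f`_i * a ^+ i.
Proof.
elim/poly_ind: f i => [|f b IHf] i; first by rewrite comp_poly0 !coef0 mul0r.
rewrite comp_poly_MXaddC -scalerAr !coefD coefZ !coefMX !coefC.
by case: i => [|i] /=; rewrite ?IHf ?exprS; ring.
Qed.

Hypothesis natu : forall n, n.+1%:R \is a @GRing.unit R.

Lemma shift_sub_surj d q : exists h, (h \Po ('X + d%:P)) - h = d *: q.
Proof.
have [n le_qn] := ubnP (size q); elim: n => // n IHn in q le_qn *.
case: n => [|n] in IHn le_qn *.
  exists 0; move: le_qn; rewrite ltnS leqn0 size_poly_eq0 => /eqP->.
  by rewrite comp_poly0 subrr scaler0.
rewrite ltnS in le_qn.
(* The difference of u x^(n+1) is d r, where [r] has coefficient (n + 1) u at index n; this choice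
   of [u] makes it agree with [q] there. Factoring x^(n+1) differences by [subrXX] avoids dividing
   by [d]. *)
pose u := q`_n / n.+1%:R.
pose r := u *: \sum_(i < n.+1) ('X + d%:P) ^+ (n - i) * 'X^i.
have uXE : ((u *: 'X^(n.+1)) \Po ('X + d%:P)) - u *: 'X^(n.+1) = d *: r.
  rewrite comp_polyZ rmorphXn /= comp_polyX -scalerBr subrXX addrC addKr.
  by rewrite mul_polyC !scalerA mulrC.
have [h hE] : exists h, (h \Po ('X + d%:P)) - h = d *: (q - r).
  apply: IHn; rewrite ltnS; apply/leq_sizeP => j.
  have mon (i : 'I_n.+1) : ('X + d%:P) ^+ (n - i) * 'X^i \is monic.
    by rewrite rpredM ?monicXn ?rpredX ?monicXaddC.
  have szE (i : 'I_n.+1) : size (('X + d%:P) ^+ (n - i) * 'X^i) = n.+1.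
    rewrite size_Mmonic ?monicXn ?monic_neq0 ?monic_exp ?monicXaddC //.
    rewrite size_polyXn -[d]opprK polyCN size_exp_XsubC addSn addnS /=.
    by rewrite subnK // -ltnS.
  rewrite leq_eqVlt coefB coefZ coef_sum => /orP[/eqP<-|nj].
    (* Each of the n + 1 summands is monic of degree n, hence contributes 1. *)
    rewrite (eq_bigr (fun=> 1)); last first.
      by move=> i _; have := mon i; rewrite monicE lead_coefE szE => /eqP.
    by rewrite sumr_const card_ord divrK // subrr.
  rewrite nth_default ?(leq_trans le_qn) // big1 ?mulr0 ?subrr // => i _.
  by rewrite nth_default // szE.
exists (h + u *: 'X^(n.+1)); rewrite comp_polyD opprD addrACA hE uXE.
by rewrite -scalerDr subrK.
Qed.

(** Conjugacy with [h] eliminated: the correction h(x + d) - h(x) is replaced by an arbitrary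
    multiple of [d]. *)
Definition affine_conj f d g e := exists a b c,
  [/\ a \is a GRing.unit, b \is a GRing.unit, e = b * d &
      exists q, g \Po (b *: 'X + c%:P) = a *: f + d *: q].

(** Divisibility of differences gives one direction; the other solves the difference equation, which
    is where positive integers must be invertible. *)
Lemma conjBA_affineP f d g e :
  conjBA (strict f d) (strict g e) <-> affine_conj f d g e.
Proof.
rewrite conjBA_strict; split.
  case=> a [b [c [g' [h [ua ub]]]]] /strict_inj[<- ->] E; exists a, b, c; split=> //.
  by have [q qE] := shift_sub_dvd h d; exists q; rewrite E -addrA qE.
case=> a [b [c [ua ub -> [q E]]]]; have [h hE] := shift_sub_surj d q.
by exists a, b, c, g, h; split=> //; rewrite E -hE addrA.
Qed.

Lemma affine_conj_refl f d : affine_conj f d f d.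
Proof.
exists 1, 1, 0; rewrite !unitr1 mul1r; split=> //; exists 0.
by rewrite affine_id comp_polyXr scale1r scaler0 addr0.
Qed.

Lemma affine_conj_sym f d g e : affine_conj f d g e -> affine_conj g e f d.
Proof.
case=> a [b [c [ua ub -> [q E]]]].
exists a^-1, b^-1, (- (b^-1 * c)); rewrite !unitrV ua ub mulKr //; split=> //.
pose B := b^-1 *: 'X + (- (b^-1 * c))%:P.
(* Substituting [B] gives g = a f(B) + d q(B), to be solved for f(B). The modulus is now b d, whence
   the extra factor b^-1. *)
exists (- ((a^-1 * b^-1) *: (q \Po B))).
have -> : g = a *: (f \Po B) + d *: (q \Po B).
  by rewrite -!comp_polyZ -comp_polyD -E -comp_polyA affine_compVr // comp_polyXr.
rewrite -/B -!mul_polyC !polyCM.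
have [ia ib] : a^-1%:P * a%:P = 1 :> {poly R} /\ b^-1%:P * b%:P = 1 :> {poly R}.
  by rewrite -!polyCM !mulVr.
by ring: ia ib.
Qed.

Lemma affine_conj_trans f d g e h k :
  affine_conj f d g e -> affine_conj g e h k -> affine_conj f d h k.
Proof.
case=> a [b [c [ua ub -> [q E]]]] [a' [b' [c' [ua' ub' -> [q' E']]]]].
exists (a' * a), (b' * b), (b' * c + c'); rewrite !unitrM ua ub ua' ub' mulrA.
(* The second congruence has modulus b d, whence the factor [b] on [q']. *)
split=> //; exists (a' *: q + b *: (q' \Po (b *: 'X + c%:P))).
rewrite -affine_comp comp_polyA E' comp_polyD !comp_polyZ E.
by rewrite -!mul_polyC !polyCM; ring.
Qed.

Lemma conj_class_eq f d g e :
  conj_class (strict f d) = conj_class (strict g e) <-> affine_conj f d g e.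
Proof.
split=> [E|fg].
  have : conj_class (strict g e) (strict g e).
    by split; [exists g, e | apply/conjBA_affineP/affine_conj_refl].
  by rewrite -E => -[_ /conjBA_affineP].
rewrite eqEsubset; split=> G [[g' [e' ->]]] /conjBA_affineP G'.
  split; first by exists g', e'.
  exact/conjBA_affineP/(affine_conj_trans (affine_conj_sym fg)).
split; first by exists g', e'.
exact/conjBA_affineP/(affine_conj_trans fg).
Qed.

Lemma affine_conj_shift f d c : affine_conj f d (f \Po ('X + c%:P)) d.
Proof.
exists 1, 1, (- c); rewrite unitr1 mul1r; split=> //; exists 0.
by rewrite !scale1r scaler0 addr0 polyCN comp_polyXaddC_K.
Qed.

(** Conjugation by (l^-1 x_1, l^-1 x_2) realizes [scale_act]. It also rescales [d], but by a unit,
    so the ideal of [d] is preserved. *)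
Lemma affine_conj_scale f d l :
  l \is a GRing.unit -> affine_conj f d (scale_act l f) (l^-1 * d).
Proof.
move=> ul; exists l^-1, l^-1, 0; rewrite unitrV ul; split=> //; exists 0.
rewrite scaler0 addr0 addr0 /scale_act comp_polyZ -comp_polyA comp_polyZ comp_polyX.
by rewrite scalerA mulrV // scale1r comp_polyXr.
Qed.

Lemma affine_conj_res f d g : res_poly (ideal d) f g -> affine_conj f d g d.
Proof.
move=> /res_polyP[q ->]; exists 1, 1, 0; rewrite unitr1 mul1r; split=> //.
by exists q; rewrite affine_id comp_polyXr scale1r.
Qed.

End Shift.

Lemma natr_unit (R : idomainType) (iota : {rmorphism rat -> R}) n :
  n.+1%:R \is a @GRing.unit R.
Proof.
by rewrite -(rmorph_nat iota); apply: rmorph_unit; rewrite unitfE Num.Theory.pnatr_eq0.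
Qed.

(** * Normalizing the next-to-leading coefficient by a translation *)

Section Normalize.
Variable R : idomainType.
Implicit Types (f g h q : {poly R}) (a b c d e : R).
Hypothesis natu : forall n, n.+1%:R \is a @GRing.unit R.

Lemma normalize S f : coef_choice S ->
  exists c, normalized S (f \Po ('X + c%:P)).
Proof.
move=> SP; case sf: (size f) => [|[|n]].
- by exists 0 => m; rewrite size_comp_shift sf.
- by exists 0 => m; rewrite size_comp_shift sf.
have [_ /(_ f`_n I)[t [[St [r tE]] _]]] := SP f`_n.+1.
(* The translation adds (n + 1) c times the leading coefficient, and r times it is wanted. *)
exists (r / n.+1%:R) => m; rewrite size_comp_shift sf => -[<-].
rewrite comp_shift_coefS ?sf // comp_shift_coef ?sf //.
by rewrite [_ * _ * (_ / _)]mulrC mulrA mulrVK // -tE.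
Qed.

Lemma res_eq d a b : ideal d (a - b) -> res (ideal d) a = res (ideal d) b.
Proof.
case=> q qE; rewrite eqEsubset; split=> x [p pE].
  by exists (p + q); rewrite mulrDl -pE -qE; ring.
by exists (p - q); rewrite mulrBl -pE -qE; ring.
Qed.

Lemma ideal0 d : ideal d 0.
Proof. by exists 0; rewrite mul0r. Qed.

Lemma res_polyxx d f : res_poly (ideal d) f f.
Proof. by move=> i; rewrite subrr; apply: ideal0. Qed.

Lemma res_poly_eq d f g : res_poly (ideal d) f g ->
  res_poly (ideal d) f = res_poly (ideal d) g.
Proof.
move=> /res_polyP[q ->]; rewrite eqEsubset; split=> x /res_polyP[p ->]; apply/res_polyP.
  by exists (p - q); rewrite scalerBr addrACA subrr addr0.
by exists (p + q); rewrite scalerDr [d *: p + _]addrC addrA.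
Qed.

Lemma normalize_res S d f : d != 0 -> coef_choice_res S ->
  exists c, normalized_res S (ideal d) (res_poly (ideal d) (f \Po ('X + c%:P))).
Proof.
move=> d0 SP; set I := ideal d.
(* Either [f] has a positive degree n + 1 modulo [d], or no lift of its class has one and the
   condition is vacuous with c = 0. *)
have [[n [fn fgt]]|nof] := pselect (exists n, ~ I f`_n.+1 /\
   forall i, (n.+1 < i)%N -> I f`_i); last first.
  exists 0; split=> [|f' n]; first by exists (f \Po ('X + 0%:P)).
  rewrite addr0 comp_polyXr => /res_polyP[q f'E] f'n f'gt; case: nof; exists n.
  split=> [[p pE]|i /f'gt[p]].
    by apply: f'n; exists (p + q`_n.+1); rewrite f'E coefD coefZ pE; ring.
  rewrite f'E coefD coefZ => pE; exists (p - q`_i).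
  by rewrite mulrBl -pE; ring.
have [Ssub Sex] := SP d f`_n.+1 d0.
have [|t [[St [a [b [r [[qa Ea] [qb Eb] tb]]]]] _]] := Sex (res I f`_n).
  by exists f`_n.
(* [t0] lifts the chosen representative; modulo [d] it equals the coefficient of index n of [f] plus
   [r] times that of index n + 1. *)
have [t0 _ tE] := Ssub _ St; have [qt Et] : res I t0 (b + r * a) by rewrite tE.
pose c := r / n.+1%:R; exists c; split=> [|f' m]; first by exists (f \Po ('X + c%:P)).
(* The terms above n + 1 vanish only modulo [d]; dropping them gives a lift to which the coefficient
   formulas apply. *)
pose f0 := take_poly n.+2 f.
have /res_polyP[q0 fE] : res_poly I f0 f.
  move=> i; rewrite coef_take_poly; case: ltnP => [_|ni].
    by rewrite subrr; apply: ideal0.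
  by rewrite subr0; apply: fgt.
(* Every lift f' of the translated class is f0(x + c) + d q: the error of the truncation and that of
   the lift are merged in [q]. *)
move=> /res_polyP[q1]; rewrite fE comp_polyD comp_polyZ -addrA -scalerDr.
move: (_ + q1) => q f'E.
have sf0 : (size f0 <= n.+2)%N := size_take_poly _ _.
have f'n1 : f'`_n.+1 = f`_n.+1 + d * q`_n.+1.
  by rewrite f'E coefD coefZ comp_shift_coefS // coef_take_poly ltnSn.
have f'n : f'`_n = f`_n + f`_n.+1 * r + d * q`_n.
  rewrite f'E coefD coefZ comp_shift_coef // !coef_take_poly ltnSn ltnW //.
  by rewrite [_ * _ * c]mulrAC [_ * c]mulrC /c mulrVK // [r * _]mulrC.
have f'gt i : (n.+1 < i)%N -> f'`_i = d * q`_i.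
  move=> ni; rewrite f'E coefD coefZ nth_default ?add0r //.
  by rewrite size_comp_shift (leq_trans sf0).
move=> f'm f'mgt.
(* The degree modulo [d] depends neither on the lift nor on the translation. *)
have <- : n = m.
  apply/eqP; rewrite eqn_leq; apply/andP; split; rewrite leqNgt; apply/negP=> lt.
    have [|p pE] := f'mgt n.+1; first by rewrite ltnS.
    by apply: fn; exists (p - q`_n.+1); rewrite mulrBl -pE f'n1; ring.
  by apply: f'm; exists q`_m.+1; rewrite f'gt ?ltnS // mulrC.
rewrite (_ : res I f'`_n.+1 = res I f`_n.+1); last first.
  by apply: res_eq; exists q`_n.+1; rewrite f'n1; ring.
rewrite (_ : res I f'`_n = t) // -tE; apply: res_eq.
exists (q`_n + qt - qb - r * qa).
by rewrite f'n !(mulrDl, mulNr) -mulrA -Ea -Eb -Et; ring.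
Qed.

Lemma ideal_unit l d : l \is a GRing.unit -> ideal (l * d) = ideal d.
Proof.
move=> ul; rewrite eqEsubset; split=> x [q ->].
  by exists (q * l); rewrite mulrA.
by exists (q / l); rewrite mulrA mulrVK.
Qed.

Lemma res_poly0 f g : res_poly (ideal 0) f g <-> g = f.
Proof.
split=> [/res_polyP[q ->]|->]; first by rewrite scale0r addr0.
by apply: res_polyxx.
Qed.

(** * From parameters to conjugacy classes *)

Section Params.
Variables (S1 : R -> set R) (T1 : set {poly R}).
Variables (S2 : set R -> set R -> set (set R)) (T2 : set R -> set (set {poly R})).
Hypotheses (S1P : coef_choice S1) (S2P : coef_choice_res S2).
Hypothesis T1P : representatives (normalized S1) (@scale_orbit R) T1.
Hypothesis T2P : orbit_choice_res S2 T2.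

Let P := params1 T1 `|` params2 T2.

(** As the ideal of 0 is zero, the singletons of the case f2 = 0 are cosets too, and both cases can
    be treated together from here on. *)
Lemma param_coset p : P p -> exists f, p.1 = res_poly (ideal p.2) f.
Proof.
case=> [[f _ ->]|[p0 Tp]] /=.
  by exists f; apply/seteqP; split=> g /res_poly0.
by have [Tsub _] := T2P p0; have [[f _ <-] _] := Tsub _ Tp; exists f.
Qed.

Lemma param_classE p f : P p -> p.1 f -> param_class p = conj_class (strict f p.2).
Proof.
move=> /param_coset[f0 pE] pf; rewrite /param_class eqEsubset.
split=> [G [g pg]|G]; last first.
  by exists f.
suff -> : conj_class (strict g p.2) = conj_class (strict f p.2) by [].
apply/conj_class_eq => //; apply: (@affine_conj_trans _ _ _ f0 p.2).
  by apply/affine_conj_sym/affine_conj_res; rewrite -pE.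
by apply/affine_conj_res; rewrite -pE.
Qed.

Lemma param_class_image : @param_class R @` P = @conj_classes R.
Proof.
rewrite eqEsubset; split=> [_ [p Pp <-]|_ [_ [f [d ->]] <-]].
  have [f pE] := param_coset Pp.
  have pf : p.1 f by rewrite pE; apply: res_polyxx.
  by rewrite (param_classE Pp pf); exists (strict f p.2) => //; exists f, p.2.
suff [p [g [Pp pg fg]]] : exists p g, [/\ P p, p.1 g & affine_conj f d g p.2].
  by exists p => //; rewrite (param_classE Pp pg); apply/esym/conj_class_eq.
have [d0|d0] := eqVneq d 0.
  have [c cP] := normalize f S1P.
  have [_ /(_ _ cP)[g [[Tg [l ul gE]] _]]] := T1P.
  exists ([set g], 0), g; split=> //; first by left; exists g.
  rewrite gE d0 /=; apply: affine_conj_trans (affine_conj_shift f 0 c) _.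
  by rewrite -[X in affine_conj _ _ _ X](mulr0 l^-1); apply: affine_conj_scale.
have [c cP] := normalize_res f d0 S2P.
have [_ /(_ _ cP)[t [[Tt [l ul tE]] _]]] := T2P d0.
(* Scaling the polynomial forces l^-1 d as second component; it generates the same ideal, so [t] is
   still an admissible choice. *)
exists (t, l^-1 * d), (scale_act l (f \Po ('X + c%:P))); split=> /=.
- right; split=> /=; last by rewrite ideal_unit // unitrV.
  by rewrite mulf_neq0 // invr_eq0; apply: contraTneq ul => ->; rewrite unitr0.
- by rewrite tE; exists (f \Po ('X + c%:P)) => //; apply: res_polyxx.
- exact: affine_conj_trans (affine_conj_shift f d c) (affine_conj_scale _ _ ul).
Qed.

Lemma param_class_eq (p q : param R) : P p -> P q ->
  param_class p = param_class q <-> same_param_class p q.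
Proof.
move=> Pp Pq; split=> [E|[a [b [c [f [g [[ua ub] [pf qg] qE fg]]]]]]].
  have [f pE] := param_coset Pp; have [g qE] := param_coset Pq.
  have pf : p.1 f by rewrite pE; apply: res_polyxx.
  have qg : q.1 g by rewrite qE; apply: res_polyxx.
  move: E; rewrite (param_classE Pp pf) (param_classE Pq qg) conj_class_eq //.
  case=> a [b [c [ua ub dE fg]]]; exists a, b, c, f, g; split=> //.
  exact/res_polyP.
rewrite (param_classE Pp pf) (param_classE Pq qg) conj_class_eq //.
by exists a, b, c; split=> //; apply/res_polyP.
Qed.

End Params.

End Normalize.

(** * Depressed polynomials over a field *)

Section Field.
Variable k : fieldType.
Implicit Types (f g : {poly k}) (a b c d : k).
Hypothesis natu : forall n, n.+1%:R \is a @GRing.unit k.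

Lemma depress f : f != 0 -> exists c, depressed (f \Po ('X + c%:P)).
Proof.
move=> f0; pose n := (size f).-2.
(* The root of f_n + (n + 1) f_(n+1) c = 0. For constant [f] the division is by 0, so c = 0, and the
   condition on the coefficient is vacuous. *)
exists (- (f`_n / (n.+1%:R * f`_n.+1))); split.
  by rewrite -size_poly_gt0 size_comp_shift size_poly_gt0.
move=> m; rewrite size_comp_shift => sf.
have <- : n = m by rewrite /n sf.
have {m}sf : size f = n.+2 by rewrite sf /n sf.
have fn : n.+1%:R * f`_n.+1 \is a GRing.unit.
  by rewrite unitrM natu unitfE; move: f0; rewrite -lead_coef_eq0 lead_coefE sf.
by rewrite comp_shift_coef ?sf // mulrN mulrCA mulrV // mulr1 subrr.
Qed.

Lemma affine_conj_depressed f g : depressed f -> depressed g ->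
  affine_conj f 0 g 0 <-> exists a b, [/\ a != 0, b != 0 & a *: f = g \Po (b *: 'X)].
Proof.
move=> [f0 fd] [g0 gd]; split=> [[a [b [c [ua ub _ [q]]]]]|[a [b [a0 b0 E]]]]; last first.
  exists a, b, 0; rewrite !unitfE mulr0; split=> //; exists 0.
  by rewrite !addr0 scaler0 addr0.
(* Modulo 0 the congruence is an equality. It remains to discard the translation: constants do not
   see it, and in positive degree c = 0. *)
rewrite scale0r addr0 => E; exists a, b; rewrite -!unitfE; split=> //.
suff gc : g \Po (b *: 'X + c%:P) = g \Po (b *: 'X) by rewrite -E gc.
case sg: (size g) => [|[|n]].
- by move: g0; rewrite -size_poly_eq0 sg.
- by have /size1_polyC-> : (size g <= 1)%N; rewrite ?sg // !comp_polyC.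
have sf : size f = n.+2.
  rewrite unitfE in ua; rewrite unitfE in ub.
  rewrite -sg -(size_scale f ua) -E size_comp_poly2 //.
  by rewrite -mul_polyC size_MXaddC polyC_eq0 (negbTE ub) size_polyC ub.
have AE : b *: 'X + c%:P = ('X + c%:P) \Po (b *: 'X).
  by rewrite comp_polyD comp_polyX comp_polyC.
suff -> : c = 0 by rewrite addr0.
(* Both polynomials being depressed, comparison at index n leaves (n + 1) g_(n+1) c b^n = 0, in
   which only [c] can vanish. *)
have /(congr1 (fun p : {poly k} => p`_n)) := E.
rewrite AE comp_polyA comp_scale_coef coefZ fd // mulr0 comp_shift_coef ?sg // gd //.
rewrite add0r.
move/eqP; rewrite !mulf_eq0 expf_eq0 => /orP[/orP[/orP[]|]|/andP[_]].
- by move/eqP=> n0; have := natu n; rewrite n0 unitr0.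
- by move=> /eqP gn; move: g0; rewrite -lead_coef_eq0 lead_coefE sg gn eqxx.
- by move/eqP.
- by move/eqP=> b0; move: ub; rewrite b0 unitr0.
Qed.

End Field.

Theorem theorem2p13 :
  (forall (R : idomainType) (iota : {rmorphism rat -> R})
      (S1 : R -> set R) (T1 : set {poly R})
      (S2 : set R -> set R -> set (set R)) (T2 : set R -> set (set {poly R})),
    coef_choice S1 ->
    representatives (normalized S1) (@scale_orbit R) T1 ->
    coef_choice_res S2 ->
    orbit_choice_res S2 T2 ->
    let P := params1 T1 `|` params2 T2 in
    [/\ forall p f, P p -> p.1 f -> param_class p = conj_class (strict f p.2),
        @param_class R @` P = @conj_classes R &
        forall p q, P p -> P q ->
          param_class p = param_class q <-> same_param_class p q])
  /\
  (forall (k : fieldType) (iota : {rmorphism rat -> k}) (T : set {poly k}),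
    representatives (@depressed k) (@scale_orbit k) T ->
    let C1 := [set conj_class (strict f 0) | f in T] in
    let C2 := conj_class (strict (0 : {poly k}) 1) in
    let C3 := conj_class (strict (0 : {poly k}) 0) in
    [/\ @conj_classes k = C1 `|` [set C2] `|` [set C3],
        [/\ ~ C1 C2, ~ C1 C3 & C2 <> C3] &
        forall f g, T f -> T g ->
          conj_class (strict f 0) = conj_class (strict g 0) <->
          exists a1 a2 : k, [/\ a1 != 0, a2 != 0 & a1 *: f = g \Po (a2 *: 'X)]]).
Proof.
split=> [R iota S1 T1 S2 T2 S1P T1P S2P T2P P|k iota T [Tsub Tex] C1 C2 C3].
  have natu := natr_unit iota.
  split; first exact: param_classE T2P.
    exact: (param_class_image natu S1P S2P T1P T2P).
  exact: param_class_eq T2P.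
have natu := natr_unit iota.
split.
- rewrite eqEsubset; split=> [_ [_ [f [d ->]] <-]|_ [[[f _ <-]|->]|->]]; last first.
  + by exists (strict 0 0) => //; exists 0, 0.
  + by exists (strict 0 1) => //; exists 0, 1.
  + by exists (strict f 0) => //; exists f, 0.
  have [->|d0] := eqVneq d 0; last first.
    (* A nonzero [d] is a unit: scaling x_2 by d^-1 turns it into 1, and every polynomial is a
       multiple of [d], so [f] can be cancelled. *)
    left; right; apply/conj_class_eq => //; exists 1, d^-1, 0.
    rewrite unitr1 unitrV unitfE d0 mulVf //; split=> //; exists (- (d^-1 *: f)).
    by rewrite comp_poly0 scale1r scalerN scalerA mulfV // scale1r subrr.
  have [->|f0] := eqVneq f 0; first by right.
  have [c cP] := depress natu f0; have [g [[Tg [l ul gE]] _]] := Tex _ cP.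
  left; left; exists g => //; apply/esym/conj_class_eq => //.
  rewrite gE; apply: affine_conj_trans (affine_conj_shift f 0 c) _.
  by rewrite -[X in affine_conj _ _ _ X](mulr0 l^-1); apply: affine_conj_scale.
(* Conjugation multiplies the second component by a unit, which isolates [C2]. With second component
   0, only the zero polynomial is conjugate to zero, and it is not depressed. *)
- split=> [[f Tf]|[f Tf]|]; rewrite (conj_class_eq natu).
  + by move=> [a [b [c [_ _ /eqP + _]]]]; rewrite mulr0 oner_eq0.
  + move=> [a [b [c [ua _ _ [q]]]]]; rewrite comp_poly0 scale0r addr0.
    move=> /esym/eqP; rewrite scaler_eq0 => /orP[/eqP a0|f0].
      by move: ua; rewrite a0 unitr0.
    by have [] := Tsub _ Tf; rewrite f0.
  + move=> [a [b [c [_ + + _]]]]; rewrite mulr1 => /[swap] <-.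
    by rewrite unitr0.
- move=> f g Tf Tg; rewrite conj_class_eq //.
  by apply: affine_conj_depressed => //; apply: Tsub.
Qed.
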